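(* Let $T$ be a nonnegative tensor of order $m$ and dimension $n$. If $T$ is weakly irreducible, then $T$ is strictly nonnegative.
   Context: Throughout $m,n\ge 2$. A tensor $T$ of order $m$ and dimension $n$ is a real array $(T_{i_1\ldots i_m})$, $i_1,\dots,i_m\in\{1,\ldots,n\}$; nonnegative means all entries are nonnegative. Define $F_T:\mathbb{R}^n_+\to\mathbb{R}^n_+$ by $(F_T)_i(x)=\left(\sum_{i_2,\ldots,i_m=1}^n T_{ii_2\ldots i_m}x_{i_2}\cdots x_{i_m}\right)^{1/(m-1)}$. $T$ is strictly nonnegative if $F_T(x)>0$ for every $x>0$ (componentwise strict inequalities). The representation $G(T)$ is the $n\times n$ matrix whose $(i,j)$ entry is the sum of all $T_{ii_2\ldots i_m}$ over $(i_2,\ldots,i_m)$ with $j\in\{i_2,\ldots,i_m\}$; $T$ is weakly irreducible if $G(T)$ is an irreducible matrix. *)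

(* Defs.v *)
From HB Require Import structures.
From mathcomp Require Import all_boot all_order all_algebra.
From mathcomp Require Import reals exp.

Set Implicit Arguments.
Unset Strict Implicit.
Unset Printing Implicit Defensive.

Import Order.TTheory GRing.Theory Num.Theory.

Local Open Scope ring_scope.

(* The index string (i_1, ..., i_m) is an m-tuple s: i_1 is [ohead s] and      *)
(* (i_2, ..., i_m) is [behead s], which avoids casts between m and m.-1.+1.    *)
Definition tensor (R : Type) (m n : nat) := m.-tuple 'I_n -> R.

Definition nonneg_tensor (R : realType) (m n : nat) (T : tensor R m n) : Prop :=
  forall s, 0 <= T s.

(* Total on R^n; only its values on nonnegative vectors are meaningful, since  *)
(* [powR] is not an (m-1)-th root at negative arguments.                       *)
Definition tensor_map (R : realType) (m n : nat) (T : tensor R m n)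
    (x : 'cV[R]_n) : 'cV[R]_n :=
  \col_i (\sum_(s : m.-tuple 'I_n | ohead s == Some i)
            T s * \prod_(j <- behead s) x j 0) `^ (m.-1%:R)^-1.

Definition pos_vector (R : realType) (n : nat) (x : 'cV[R]_n) : Prop :=
  forall i, 0 < x i 0.

Definition strictly_nonneg (R : realType) (m n : nat) (T : tensor R m n) : Prop :=
  forall x : 'cV[R]_n, pos_vector x -> pos_vector (tensor_map T x).

Definition tensor_repr (R : realType) (m n : nat) (T : tensor R m n) : 'M[R]_n :=
  \matrix_(i, j)
    \sum_(s : m.-tuple 'I_n | (ohead s == Some i) && (j \in behead s)) T s.

Definition reducible_mx (R : realType) (n : nat) (A : 'M[R]_n) : Prop :=
  exists I : {set 'I_n},
    [/\ I != set0, I != [set: 'I_n] &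
        forall i j, i \in I -> j \notin I -> A i j = 0].

Definition irreducible_mx (R : realType) (n : nat) (A : 'M[R]_n) : Prop :=
  ~ reducible_mx A.

Definition weakly_irreducible (R : realType) (m n : nat) (T : tensor R m n) : Prop :=
  irreducible_mx (tensor_repr T).

(* Main.v *)
Require Import Defs.
From mathcomp Require Import all_boot all_order all_algebra.
From mathcomp Require Import reals exp.

Import Order.TTheory GRing.Theory Num.Theory.

Local Open Scope ring_scope.

(** At a positive vector every monomial is positive, so the i-th component of
    the tensor map vanishes only if all the entries with first index i do.
    Then row i of the representation vanishes as well, and since n >= 2 the
    singleton {i} is a proper nonempty set that reduces the representation.
    Irreducibility thus yields a nonzero entry in each row of the
    representation ([irreducible_mx_row_neq0]), hence a nonzero tensor entry
    with first index i ([tensor_repr_entry_neq0]), whose monomial makes the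
    component positive ([tensor_map_gt0]). *)

(** The order-one matrix (0) is irreducible, as no set of indices is both
    nonempty and proper; hence the bound on n. *)
Lemma irreducible_mx_row_neq0 (R : realType) (n : nat) (A : 'M[R]_n)
    (i : 'I_n) :
  (2 <= n)%N -> irreducible_mx A -> exists j, A i j != 0.
Proof.
move=> n_ge2 irrA; apply/existsP; apply: contra_notT irrA.
rewrite negb_exists => /forallP rowi0; exists [set i]; split.
- by apply/set0Pn; exists i; rewrite inE.
- apply/eqP => /(congr1 (fun I : {set 'I_n} => #|I|)).
  by rewrite cards1 cardsT card_ord => n1; rewrite -n1 in n_ge2.
- by move=> k j; rewrite inE => /eqP-> _; apply/eqP; have := rowi0 j; rewrite negbK.
Qed.

Lemma tensor_repr_entry_neq0 (R : realType) (m n : nat) (T : tensor R m n)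
    (i j : 'I_n) :
  tensor_repr T i j != 0 ->
  exists2 s : m.-tuple 'I_n, ohead s == Some i & T s != 0.
Proof.
rewrite mxE => sum_neq0; apply/exists_inP; apply: contraNT sum_neq0.
rewrite negb_exists_in => /forall_inP T0.
rewrite big1 // => s /andP[si _].
by apply/eqP; rewrite -[_ == _]negbK T0.
Qed.

Lemma tensor_map_gt0 (R : realType) (m n : nat) (T : tensor R m n)
    (x : 'cV[R]_n) (s : m.-tuple 'I_n) (i : 'I_n) :
  nonneg_tensor T -> pos_vector x -> ohead s == Some i -> T s != 0 ->
  0 < tensor_map T x i 0.
Proof.
move=> T_ge0 x_gt0 si Ts_neq0.
have mon_gt0 (t : m.-tuple 'I_n) : 0 < \prod_(j <- behead t) x j 0.
  by apply: prodr_gt0 => j _; apply: x_gt0.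
rewrite mxE; apply: powR_gt0; rewrite (bigD1 s) //=.
apply: ltr_wpDr.
  by apply: sumr_ge0 => t _; rewrite mulr_ge0 ?T_ge0 // ltW.
by rewrite mulr_gt0 // lt_def Ts_neq0 T_ge0.
Qed.

Theorem corollary2p1 (R : realType) (m n : nat) (hm : (2 <= m)%N) (hn : (2 <= n)%N)
    (T : tensor R m n) :
  nonneg_tensor T -> weakly_irreducible T -> strictly_nonneg T.
Proof.
move=> T_ge0 irrT x x_gt0 i.
have [j /tensor_repr_entry_neq0[s si Ts]] :=
  irreducible_mx_row_neq0 _ _ _ i hn irrT.
exact: tensor_map_gt0 T_ge0 x_gt0 si Ts.
Qed.
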